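(* Let $X$ be a Polish space, with any compatible metric. Suppose that $C_1\cap C_2$ is connected for any two continua $C_1,C_2\subset X$. Then $E_X^{CC}=E_X^A$.
   Context: A continuum is a nonempty compact connected metrizable space (single points are continua); an arc is a homeomorphic copy of $[0,1]$. The empty set counts as connected. For a metric space $X$, the chain continuum-connection relation $E_X^{CC}$ on $X$ is: $x\,E_X^{CC}\,y$ iff for every $\varepsilon>0$ there are $n\in\mathbb{N}$ and continua $K_0,\dots,K_n\subset X$ of diameter $<\varepsilon$ such that $x\in K_0$, $y\in K_n$ and $K_i\cap K_{i+1}\neq\emptyset$ for $0\le i<n$. The arc-connection relation is $x\,E_X^A\,y$ iff $x=y$ or there is an arc in $X$ containing $x$ and $y$. *)

(* Defs.v *)
From mathcomp Require Import all_boot all_order all_algebra.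
From mathcomp Require Import all_classical all_reals all_analysis.

Set Implicit Arguments.
Unset Strict Implicit.
Unset Printing Implicit Defensive.

Import Order.TTheory GRing.Theory Num.Theory.
Import numFieldNormedType.Exports.

Local Open Scope classical_set_scope.
Local Open Scope ring_scope.

Definition is_distance (R : realType) (T : Type) (d : T -> T -> R) : Prop :=
  [/\ forall x, d x x = 0,
      forall x y, d x y = 0 -> x = y,
      forall x y, d x y = d y x &
      forall x y z, d x z <= d x y + d y z].

Definition compatible_distance (R : realType) (T : topologicalType)
    (d : T -> T -> R) : Prop :=
  is_distance d /\
  forall x : T, nbhs x =
    filter_from [set e : R | 0 < e] (fun e => [set y | d x y < e]).

(* For a compatible distance, convergence in the topology of T is the same as
   convergence for d. *)
Definition complete_distance (R : realType) (T : topologicalType)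
    (d : T -> T -> R) : Prop :=
  forall u : nat -> T,
    (forall e : R, 0 < e -> exists N : nat, forall m n : nat,
       (N <= m)%N -> (N <= n)%N -> d (u m) (u n) < e) ->
    exists l : T, u @ \oo --> l.

(* A property of the topology: when T is a metricType, the complete distance d
   need not be mdist. *)
Definition polish_space (R : realType) (T : topologicalType) : Prop :=
  (exists2 D : set T, countable D & dense D) /\
  exists2 d : T -> T -> R, compatible_distance d & complete_distance d.

(* Metrizability is automatic for a subspace of a metric space. *)
Definition continuum (R : realType) (X : metricType R) (K : set X) : Prop :=
  [/\ K !=set0, compact K & connected K].

(* The diameter of set0 is -oo. *)
Definition diameter (R : realType) (X : metricType R) (A : set X) : \bar R :=
  ereal_sup [set (mdist p.1 p.2)%:E | p in A `*` A].

(* A and B carry their subspace topologies; the values of f outside A and of g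
   outside B are irrelevant. *)
Definition homeomorphic (T U : topologicalType) (A : set T) (B : set U) : Prop :=
  exists (f : T -> U) (g : U -> T),
    [/\ (forall x, A x -> B (f x)) /\ (forall y, B y -> A (g y)),
        (forall x, A x -> g (f x) = x) /\ (forall y, B y -> f (g y) = y),
        {within A, continuous f} &
        {within B, continuous g}].

Definition is_arc (R : realType) (X : metricType R) (A : set X) : Prop :=
  homeomorphic (`[0%R, 1%R] : set R) A.

Definition ECC (R : realType) (X : metricType R) (x y : X) : Prop :=
  forall e : R, 0 < e ->
    exists (n : nat) (K : nat -> set X),
      [/\ forall i, (i <= n)%N -> continuum (K i) /\ (diameter (K i) < e%:E)%E,
          K 0%N x,
          K n y &
          forall i, (i < n)%N -> K i `&` K i.+1 !=set0].

Definition EA (R : realType) (X : metricType R) (x y : X) : Prop :=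
  x = y \/ exists A : set X, [/\ is_arc A, A x & A y].

(* Main.v *)
(** Let [x ECC y]. Since continua meet in connected sets, a compactness argument
    gives a smallest continuum [hull x y] containing [x] and [y]; it is covered by
    finitely many continua of diameter less than [e], for every [e]. Because of
    these fine covers, [p <= q] iff [hull x p] is included in [hull x q] is a
    total order on [hull x y], and [q] close to [p] lies with [p] in a small
    continuum, so that [hull x p] varies continuously with [p]. For a dense
    sequence [u], the function [p |-> sum_i 2^-(i+1) min(1, d(u_i, hull x p))] is
    then continuous and strictly monotone on [hull x y], which makes the
    continuum [hull x y] homeomorphic to a segment. Conversely, along an arc the
    points reachable from [x] by chains of small subarcs form a clopen set. *)
Require Import Defs.
From mathcomp Require Import all_boot all_order all_algebra.
From mathcomp Require Import all_classical all_reals all_analysis.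
From mathcomp Require Import lra.

Set Implicit Arguments.
Unset Strict Implicit.
Unset Printing Implicit Defensive.

Import Order.TTheory GRing.Theory Num.Theory.
Import numFieldNormedType.Exports.

Local Open Scope classical_set_scope.
Local Open Scope ring_scope.

(** * Chains of small continua and hulls of two points *)

Section Continua.
Context {R : realType} {X : metricType R}.
Implicit Types (K L A B H : set X) (x y z p q : X) (e : R).

Lemma mdist_diameter K e p q :
  (diameter K < e%:E)%E -> K p -> K q -> mdist p q < e.
Proof.
move=> Ke Kp Kq; rewrite -lte_fin; apply: le_lt_trans Ke.
by apply: ereal_sup_ubound; exists (p, q).
Qed.

Lemma diameter_le K e :
  (forall p q, K p -> K q -> mdist p q <= e) -> (diameter K <= e%:E)%E.
Proof.
by move=> Ke; apply: ge_ereal_sup => _ [[p q] [/= Kp Kq] <-]; rewrite lee_fin Ke.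
Qed.

Lemma compact_metric_closed K : compact K -> closed K.
Proof. by apply: compact_closed; exact: metric_hausdorff. Qed.

Lemma continuum1 x : continuum [set x].
Proof. by split; [exists x|exact: compact_set1|exact: connected1]. Qed.

Lemma continuumU K L :
  K `&` L !=set0 -> continuum K -> continuum L -> continuum (K `|` L).
Proof.
move=> KL [[x Kx] cK kK] [_ cL kL]; split; first by exists x; left.
  exact: compactU.
exact: connectedU.
Qed.

Lemma continuum_chain n (K : nat -> set X) :
  (forall i, (i <= n)%N -> continuum (K i)) ->
  (forall i, (i < n)%N -> K i `&` K i.+1 !=set0) ->
  continuum (\bigcup_(i in [set i | (i <= n)%N]) K i).
Proof.
elim: n => [|n IHn] cK iK.
  rewrite (_ : \bigcup_(i in _) _ = K 0%N); first exact: cK.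
  apply/seteqP; split=> [p [i /=]|p Kp]; last by exists 0%N.
  by rewrite leqn0 => /eqP ->.
rewrite (_ : \bigcup_(i in _) _ =
    \bigcup_(i in [set i | (i <= n)%N]) K i `|` K n.+1); last first.
  apply/seteqP; split=> [p [i /=]|p [[i /= lein Kp]|Kp]].
  - by rewrite leq_eqVlt => /predU1P[->|/= lein] Kp; [right|left; exists i].
  - by exists i => //=; exact: leqW.
  - by exists n.+1 => /=.
apply: continuumU; last exact: cK.
  by have [p [Kp KSp]] := iK n (ltnSn n); exists p; split=> //; exists n => /=.
by apply: IHn => i lein; [apply: cK; exact: leqW|apply: iK; exact: leqW].
Qed.

(** [ECC] at one fixed scale: [ECC x y] unfolds to [linked e x y] for all positive [e]. *)
Definition linked e x y := exists (n : nat) (K : nat -> set X),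
  [/\ forall i, (i <= n)%N -> continuum (K i) /\ (diameter (K i) < e%:E)%E,
      K 0%N x, K n y & forall i, (i < n)%N -> K i `&` K i.+1 !=set0].

Lemma diameter1_lt x e : 0 < e -> (diameter [set x] < e%:E)%E.
Proof.
move=> e0; apply: (@le_lt_trans _ _ 0%:E); last by rewrite lte_fin.
by apply: diameter_le => p q -> ->; rewrite mdistxx.
Qed.

Lemma linked_refl e x : 0 < e -> linked e x x.
Proof.
move=> e0; exists 0%N, (fun=> [set x]); split=> // i _.
by split; [exact: continuum1|exact: diameter1_lt].
Qed.

Lemma linked_sym e x y : linked e x y -> linked e y x.
Proof.
move=> [n [K [cK Kx Ky iK]]]; exists n, (fun i => K (n - i)%N); split=> //.
- by move=> i _; apply: cK; exact: leq_subr.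
- by rewrite subn0.
- by rewrite subnn.
- move=> i ltin; rewrite setIC.
  by have := iK (n - i.+1)%N; rewrite subnSK // leq_subr; apply.
Qed.

Lemma linked_extend e x p q L : continuum L -> (diameter L < e%:E)%E ->
  L p -> L q -> linked e x p -> linked e x q.
Proof.
move=> cL dL Lp Lq [n [K [cK Kx Kp iK]]].
exists n.+1, (fun i => if (i <= n)%N then K i else L); split=> //.
- by move=> i _; case: ifPn => // lein; exact: cK.
- by rewrite ltnn.
- move=> i; rewrite ltnS => lein; rewrite lein; case: ltnP => [ltin|leni].
    exact: iK.
  have -> : i = n by apply/eqP; rewrite eqn_leq lein.
  by exists p.
Qed.

Lemma linked_continuum e x y : linked e x y ->
  exists K, [/\ continuum K, K x & K y].
Proof.
move=> [n [K [cK Kx Ky iK]]].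
exists (\bigcup_(i in [set i | (i <= n)%N]) K i); split.
- by apply: continuum_chain => // i /cK[].
- by exists 0%N => /=.
- by exists n => /=.
Qed.

Lemma ECC_sym x y : ECC x y -> ECC y x.
Proof. by move=> xy e e0; apply: linked_sym; exact: xy. Qed.

Lemma ECC_continuum x y : ECC x y -> exists K, [/\ continuum K, K x & K y].
Proof. by move=> /(_ 1 ltr01)/linked_continuum. Qed.

(* Meaningful only when some continuum contains both points; otherwise the
   intersection is the whole space. *)
Definition hull x y : set X :=
  \bigcap_(K in [set K | [/\ continuum K, K x & K y]]) K.

Lemma hullC x y : hull x y = hull y x.
Proof.
rewrite /hull; congr bigcap; apply/seteqP.
by split=> K [cK Kx Ky]; split.
Qed.

Lemma hull_l x y : hull x y x. Proof. by move=> K []. Qed.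

Lemma hull_r x y : hull x y y. Proof. by move=> K []. Qed.

Lemma hull_min K x y : continuum K -> K x -> K y -> hull x y `<=` K.
Proof. by move=> cK Kx Ky p; apply. Qed.

(* Take the last link of a fine chain from p to y that contains p or q: the tail
   of the chain starting there is a continuum, so it contains the other point,
   and that link must contain both. *)
Lemma hull_antisym p q y : ECC p y -> hull p y q -> hull q y p -> p = q.
Proof.
move=> py qpy pqy; apply: mdist_positivity; apply/eqP.
rewrite eq_le mdist_ge0 andbT; apply/ler_addgt0Pr => e e0; rewrite add0r ltW//.
have [n [K [cK Kp Ky iK]]] := py e e0.
pose P i := (i <= n)%N && `[< K i p \/ K i q >].
have exP : exists i, P i.
  by exists 0%N; apply/andP; split=> //; apply/asboolP; left.
have ubP i : P i -> (i <= n)%N by case/andP.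
case: (ex_maxnP exP ubP) => j /andP[lejn /asboolP Kj] maxj.
have tail z z' : hull z y z' -> (z' = p \/ z' = q) -> K j z -> K j z'.
  move=> hz' Pz' Kz.
  pose T := \bigcup_(i in [set i | (i <= n - j)%N]) K (j + i)%N.
  have : T z'.
    apply: hull_min hz'.
    - apply: continuum_chain => i lei.
        by apply: (cK (j + i)%N _).1; rewrite -(subnKC lejn) leq_add2l.
      by rewrite addnS; apply: iK; rewrite -(subnKC lejn) ltn_add2l.
    - by exists 0%N => //=; rewrite addn0.
    - by exists (n - j)%N => //=; rewrite subnKC.
  move=> [i /= lei Ki].
  suff : (j + i <= j)%N.
    by rewrite -{2}(addn0 j) leq_add2l leqn0 => /eqP i0; move: Ki; rewrite i0 addn0.
  apply: maxj; rewrite /P -{1}(subnKC lejn) leq_add2l lei /=.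
  by apply/asboolP; case: Pz' Ki => ->; [left|right].
have dj := (cK j lejn).2.
case: Kj => Kj.
  by apply: (mdist_diameter dj) => //; apply: tail qpy _ Kj; right.
by apply: (mdist_diameter dj) => //; apply: tail pqy _ Kj; left.
Qed.

(** The union of a chain from [x] to [y] is a continuum, so it contains the hull; the chain can be
    cut at a link containing [p]. *)
Lemma ECC_hull x y p : ECC x y -> hull x y p -> ECC x p.
Proof.
move=> xy xyp e e0; have [n [K [cK Kx Ky iK]]] := xy e e0.
have : (\bigcup_(i in [set i | (i <= n)%N]) K i) p.
  apply: hull_min xyp; [|by exists 0%N|by exists n => /=].
  by apply: continuum_chain => // i /cK[].
move=> [j /= lejn Kp]; exists j, K; split=> // i ltij.
  by apply: cK; exact: leq_trans lejn.
by apply: iK; exact: leq_trans lejn.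
Qed.

(** A fine chain has finitely many links, all closed, so a neighbourhood of [p] misses those without
    [p]. The link through a nearby [q] of the hull therefore contains [p] too. *)
Lemma ECC_hull_near x y p e : ECC x y -> 0 < e -> \forall q \near p,
  hull x y q -> exists L, [/\ continuum L, (diameter L < e%:E)%E, L p & L q].
Proof.
move=> xy e0; have [n [K [cK Kx Ky iK]]] := xy e e0.
have avoid : \forall q \near p, forall i : 'I_n.+1, K i q -> K i p.
  apply: filter_forall => i; have [Kp|nKp] := pselect (K i p).
    exact: nearW.
  have /closed_openC oK : closed (K i).
    by apply: compact_metric_closed; have [[]] := cK i (ltn_ord i).
  have : nbhs p (~` K i) by exact: open_nbhs_nbhs.
  by apply: filterS => q nKq /nKq.
near=> q => xyq.
have : (\bigcup_(i in [set i | (i <= n)%N]) K i) q.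
  apply: hull_min xyq; [|by exists 0%N|by exists n => /=].
  by apply: continuum_chain => // i /cK[].
move=> [j /= lejn Kq]; have [cKj dKj] := cK j lejn.
exists (K j); split=> //; exact: (near avoid q _ (Ordinal (lejn : (j < n.+1)%N))).
Unshelve. all: by end_near. Qed.

End Continua.

(** * Intersections of directed families of continua *)

Section DirectedIntersection.
Context {R : realType} {X : metricType R}.
Implicit Types (K L A B H : set X) (x y z p q : X) (e : R).

(** Otherwise the sets [K]\[U] generate a proper filter on a compact set; a cluster point lies in
    every [K] but outside [U]. *)
Lemma directed_continua_sub_open (F : set (set X)) U : F !=set0 ->
  (forall K, F K -> continuum K) ->
  (forall K L, F K -> F L -> F (K `&` L)) ->
  open U -> \bigcap_(K in F) K `<=` U -> exists2 K, F K & K `<=` U.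
Proof.
move=> [K0 FK0] cF FI oU FU; apply: contrapT => noK.
pose G := filter_from F (fun K => K `\` U).
have PG : ProperFilter G.
  apply: filter_from_proper; last first.
    move=> K FK; apply: contrapT => /nonemptyPn KU; apply: noK; exists K => //.
    by rewrite -setD_eq0.
  apply: filter_from_filter; first by exists K0.
  move=> K L FK FL; exists (K `&` L); first exact: FI.
  by move=> p [[Kp Lp] nUp].
have [_ cK0 _] := cF _ FK0.
have [|p [_ Gp]] := cK0 G PG; first by exists K0 => // p [].
have inK K : F K -> (K `\` U) p.
  move=> FK; have /closure_id -> : closed (K `\` U).
    apply: closedI; last exact: open_closedC.
    by apply: compact_metric_closed; have [] := cF K FK.
  by move: Gp; rewrite clusterE; apply; exists K.
have [_] := inK _ FK0; apply; apply: FU => K FK.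
by have [] := inK K FK.
Qed.

Lemma directed_continua_bigcap (F : set (set X)) : F !=set0 ->
  \bigcap_(K in F) K !=set0 ->
  (forall K, F K -> continuum K) ->
  (forall K L, F K -> F L -> F (K `&` L)) ->
  continuum (\bigcap_(K in F) K).
Proof.
move=> F0 H0 cF FI; set H := \bigcap_(K in F) K.
have closedF K : F K -> closed K.
  by move=> FK; apply: compact_metric_closed; have [] := cF K FK.
have clH : closed H by exact: closed_bigI.
split=> //.
  have [K0 FK0] := F0; have [_ cK0 _] := cF _ FK0.
  by apply: (subclosed_compact clH cK0); exact: bigcap_inf.
move=> B B0 [C oC BC] [D cD BD]; apply: contrapT => BH.
have HnC0 : H `\` C !=set0.
  apply: contrapT => /nonemptyPn HC0; have HC : H `<=` C by rewrite -setD_eq0.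
  apply: BH.
  by rewrite BC; exact/setIidPl.
(* Normality separates the two pieces of a splitting of [H]; a member [K] inside the two open sets
   would then be split as well. *)
have /(@normal_openP R)/(_ B (H `\` C)) := @pseudometric_normal R X.
case.
- by rewrite BD; exact: closedI.
- by apply: closedI => //; exact: open_closedC.
- by apply/seteqP; split=> // p []; rewrite BC => -[_ Cp] [_ /(_ Cp)].
move=> U [V [oU oV BU HV UV]].
have [|K FK KUV] := directed_continua_sub_open F0 cF FI (openU oU oV).
  move=> p Hp; have [Cp|nCp] := pselect (C p); last by right; apply: HV.
  by left; apply: BU; rewrite BC.
have HK : H `<=` K by exact: bigcap_inf.
have disj p : U p -> ~ V p.
  by move=> Up Vp; have : (U `&` V) p by []; rewrite UV.
have [_ _ conK] := cF K FK.
(* The trace of [U] on [K] is relatively closed, being also the trace of the complement of [V]. *)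
have KU : K `&` U = K.
  apply: conK.
  - have [b Bb] := B0; exists b; split; last exact: BU.
    by apply: HK; move: Bb; rewrite BC => -[].
  - by exists U.
  - exists (~` V); first exact: open_closedC.
    apply/seteqP; split=> p [Kp].
      by move=> Up; split=> //; exact: disj.
    by move=> nVp; split=> //; have [|/nVp] := KUV p Kp.
have [p Hp] := HnC0; have : (K `&` U) p by rewrite KU; apply: HK; case: Hp.
by move=> [_ /disj]; apply; exact: HV.
Qed.

End DirectedIntersection.

(** * Hulls when continua meet in connected sets *)

Section Hull.
Context {R : realType} {X : metricType R}.
Implicit Types (K L A B H : set X) (x y z p q : X) (e : R).
Hypothesis connI : forall C1 C2 : set X,
  continuum C1 -> continuum C2 -> connected (C1 `&` C2).

(** By [connI], the continua through [x] and [y] are closed under intersection; [ECC] supplies one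
    of them. *)
Lemma hull_continuum x y : ECC x y -> continuum (hull x y).
Proof.
move=> /ECC_continuum [K0 [cK0 K0x K0y]]; apply: directed_continua_bigcap.
- by exists K0.
- by exists x; exact: hull_l.
- by move=> K [].
- move=> K L [cK Kx Ky] [cL Lx Ly]; split=> //; split; first by exists x.
    apply: compact_closedI; first by case: cK.
    by apply: compact_metric_closed; case: cL.
  exact: connI.
Qed.

Lemma hull_subr x p q : ECC x q -> hull x q p -> hull x p `<=` hull x q.
Proof.
by move=> xq pxq; apply: hull_min => //; [exact: hull_continuum|exact: hull_l].
Qed.

Lemma hull_subU x p y : ECC x p -> ECC p y ->
  hull x y `<=` hull x p `|` hull p y.
Proof.
move=> xp py; apply: hull_min.
- by apply: continuumU; [exists p; split; [exact: hull_r|exact: hull_l]|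
    exact: hull_continuum|exact: hull_continuum].
- by left; exact: hull_l.
- by right; exact: hull_r.
Qed.

(** If both alternatives fail, covering [hull x y] by two hulls meeting at [q], then at [p], puts
    [p] in [hull q y] and [q] in [hull p y], whence [p = q]. *)
Lemma hull_total x y p q : ECC x y -> hull x y p -> hull x y q ->
  hull x q p \/ hull x p q.
Proof.
move=> xy xyp xyq; have xp := ECC_hull xy xyp; have xq := ECC_hull xy xyq.
have ECC_y z : hull x y z -> ECC z y.
  by rewrite hullC => yxz; apply/ECC_sym/(ECC_hull (ECC_sym xy)).
have py := ECC_y p xyp; have qy := ECC_y q xyq.
have [|qyp] := hull_subU xq qy xyp; first by left.
have [|pyq] := hull_subU xp py xyq; first by right.
by left; rewrite (hull_antisym py pyq qyp); exact: hull_r.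
Qed.

End Hull.

(** * A real-valued gauge that detects strict inclusion of closed sets *)

Section Remoteness.
Context {R : realType} {X : metricType R}.
Implicit Types (A B : set X) (z p q v w : X) (e : R).

(* Capping at 1 makes the series below converge for unbounded X as well. *)
Definition capped_dist A z : R := inf [set Num.min 1 (mdist z w) | w in A].

Lemma capped_dist_lb A z w : A w -> capped_dist A z <= Num.min 1 (mdist z w).
Proof.
move=> Aw; apply: ge_inf; last by exists w.
by exists 0 => _ [v _ <-]; rewrite le_min ler01 mdist_ge0.
Qed.

Lemma capped_dist_glb A z e : A !=set0 ->
  (forall w, A w -> e <= Num.min 1 (mdist z w)) -> e <= capped_dist A z.
Proof.
move=> [w Aw] eA; apply: lb_le_inf; first by exists (Num.min 1 (mdist z w)), w.
by move=> _ [v Av <-]; exact: eA.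
Qed.

Lemma capped_dist_ge0 A z : A !=set0 -> 0 <= capped_dist A z.
Proof.
by move=> A0; apply: capped_dist_glb => // w _; rewrite le_min ler01 mdist_ge0.
Qed.

Lemma capped_dist_le1 A z : A !=set0 -> capped_dist A z <= 1.
Proof.
by move=> [w Aw]; rewrite (le_trans (capped_dist_lb z Aw))// ge_min lexx.
Qed.

(** A Lipschitz bound in the one-sided Hausdorff distance; [e = 0] gives monotonicity under
    inclusion. *)
Lemma capped_dist_le A B z e : 0 <= e -> B !=set0 ->
  (forall w, B w -> exists2 v, A v & mdist v w <= e) ->
  capped_dist A z <= capped_dist B z + e.
Proof.
move=> e0 B0 BA; rewrite -lerBlDr; apply: capped_dist_glb => // w Bw.
have [v Av vw] := BA w Bw.
have := capped_dist_lb z Av; rewrite !le_min => /andP[c1 cv].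
have := metric_triangle z w v; rewrite (metric_sym w v); lra.
Qed.

Lemma capped_dist_lt A B q (Z : set X) : closed A -> A !=set0 -> ~ A q -> B q ->
  dense Z -> exists2 z, Z z & capped_dist B z < capped_dist A z.
Proof.
move=> cA A0 nAq Bq dZ.
have : nbhs q (~` A) by apply: open_nbhs_nbhs; split=> //; exact: closed_openC.
rewrite -nbhs_ballE => -[r /= r0 rA].
(* A point of [Z] within [m / 2] of [q] is at least [m / 2] away from [A]; [m <= 1] keeps this true
   after capping. *)
pose m := Num.min 1 r; have m0 : 0 < m by rewrite lt_min ltr01.
have m2 : 0 < m / 2 by rewrite divr_gt0.
have m1 : m <= 1 by rewrite ge_min lexx.
have mr : m <= r by rewrite ge_min lexx orbT.
have [|z [/interior_subset qz Zz]] := dZ (ball q (m / 2))° _ (open_interior _).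
  by exists q; exact: nbhsx_ballx.
move: qz; rewrite ballEmdist/= => qz; exists z => //.
apply: (@lt_le_trans _ _ (m / 2)).
  rewrite (le_lt_trans (capped_dist_lb z Bq))// gt_min metric_sym qz.
  by rewrite orbT.
apply: capped_dist_glb => // w Aw; rewrite le_min; apply/andP; split; first lra.
have : r <= mdist q w.
  by rewrite leNgt; apply/negP => qw; apply: (rA w) => //; rewrite ballEmdist.
have := metric_triangle q z w; lra.
Qed.

Variable u : nat -> X.

Definition partial_remoteness A n : R :=
  \sum_(i < n) 2^-1 ^+ i.+1 * capped_dist A (u i).

(** The sum of a series of nonnegative terms, as the supremum of its partial sums; for nonempty [A]
    these are at most 1. *)
Definition remoteness A : R := sup (range (partial_remoteness A)).

Lemma geometric_half n : \sum_(i < n) (2^-1 : R) ^+ i.+1 = 1 - 2^-1 ^+ n.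
Proof.
elim: n => [|n IHn]; first by rewrite big_ord0 expr0 subrr.
by rewrite big_ord_recr/= IHn exprS; lra.
Qed.

Lemma geometric_half_le1 n : \sum_(i < n) (2^-1 : R) ^+ i.+1 <= 1.
Proof. by rewrite geometric_half gerBl exprn_ge0// invr_ge0. Qed.

Lemma partial_remoteness_le1 A n : A !=set0 -> partial_remoteness A n <= 1.
Proof.
move=> A0; apply: le_trans (geometric_half_le1 n).
apply: ler_sum => i _; by rewrite ler_piMr// capped_dist_le1.
Qed.

Lemma partial_remoteness_sup A n : A !=set0 ->
  partial_remoteness A n <= remoteness A.
Proof.
move=> A0; apply: sup_ubound; last by exists n.
by exists 1 => _ [k _ <-]; exact: partial_remoteness_le1.
Qed.

(** The weights sum to at most 1, so a termwise error [e] does not grow. *)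
Lemma remoteness_le A B e : 0 <= e -> A !=set0 -> B !=set0 ->
  (forall w, B w -> exists2 v, A v & mdist v w <= e) ->
  remoteness A <= remoteness B + e.
Proof.
move=> e0 A0 B0 BA; apply: sup_le_ub; first by exists (partial_remoteness A 0), 0%N.
move=> _ [n _ <-]; rewrite (@le_trans _ _ (partial_remoteness B n + e))//; last first.
  by rewrite lerD2r partial_remoteness_sup.
apply: (@le_trans _ _ (partial_remoteness B n + \sum_(i < n) 2^-1 ^+ i.+1 * e)).
  rewrite -big_split/=; apply: ler_sum => i _; rewrite -mulrDr ler_wpM2l//.
  exact: capped_dist_le.
by rewrite lerD2l -mulr_suml ler_piMl// geometric_half_le1.
Qed.

Lemma remoteness_anti A B : A !=set0 -> A `<=` B -> remoteness B <= remoteness A.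
Proof.
move=> A0 AB; rewrite -[leRHS]addr0; apply: remoteness_le => //.
  by case: A0 => w /AB; exists w.
by move=> w Aw; exists w; [exact: AB|rewrite mdistxx].
Qed.

(** One term drops by a fixed [c] and no term increases, so the gap [c] survives the supremum. *)
Lemma remoteness_lt A B q : dense (range u) -> closed A -> A !=set0 ->
  A `<=` B -> B q -> ~ A q -> remoteness B < remoteness A.
Proof.
move=> du cA A0 AB Bq nAq.
have B0 : B !=set0 by exists q.
have [_ [k _ <-] BAk] := capped_dist_lt cA A0 nAq Bq du.
pose c := 2^-1 ^+ k.+1 * (capped_dist A (u k) - capped_dist B (u k)).
have half_gt0 i : 0 < (2^-1 : R) ^+ i by rewrite exprn_gt0// invr_gt0.
have c0 : 0 < c by rewrite mulr_gt0// subr_gt0.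
suff : remoteness B <= remoteness A - c.
  by move=> /le_lt_trans; apply; rewrite gtrBl.
apply: sup_le_ub; first by exists (partial_remoteness B 0), 0%N.
have mono i : capped_dist B (u i) <= capped_dist A (u i).
  rewrite -[leRHS]addr0; apply: capped_dist_le => // w Aw.
  by exists w; [exact: AB|rewrite mdistxx].
move=> _ [n _ <-]; rewrite lerBrDr.
(* The partial sum is lengthened so that it includes the term of index [k] whatever [n] is. *)
apply: le_trans (partial_remoteness_sup (n + k.+1) A0).
apply: (@le_trans _ _ (partial_remoteness B (n + k.+1) + c)).
  rewrite lerD2r /partial_remoteness big_split_ord/= lerDl sumr_ge0// => i _.
  by rewrite mulr_ge0 ?(ltW (half_gt0 _))// capped_dist_ge0.
have ltk : (k < n + k.+1)%N by rewrite addnS ltnS leq_addl.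
rewrite /partial_remoteness (bigD1 (Ordinal ltk))//= [leRHS](bigD1 (Ordinal ltk))//=.
rewrite addrAC /c -mulrDr subrKC lerD2l; apply: ler_sum => i _.
by rewrite ler_wpM2l// ltW.
Qed.

End Remoteness.

(** * Compact bijections and locally constant predicates *)

Lemma compact_bij_homeomorphic (T U : topologicalType) (A : set T) (B : set U)
    (f : T -> U) (g : U -> T) : hausdorff_space T -> hausdorff_space U ->
  compact A -> {within A, continuous f} ->
  (forall x, A x -> B (f x)) -> (forall y, B y -> A (g y)) ->
  (forall x, A x -> g (f x) = x) -> (forall y, B y -> f (g y) = y) ->
  homeomorphic B A.
Proof.
move=> hT hU cA cf fB gA fK gK; exists g, f; split=> //.
apply/continuous_closedP => C clC; apply/closed_subspaceP.
(* On [B], the preimage of [C] under [g] is an image under [f] of a compact set, hence closed. *)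
exists (f @` (A `&` C)).
  apply: compact_closed => //; apply: continuous_compact.
    by apply: continuous_subspaceW cf; exact: subIsetl.
  exact: compact_closedI.
apply/seteqP; split=> [y [[x [Ax Cx] <-] Bfx]|y [Cgy By]]; split=> //.
  by rewrite /preimage /from_subspace/= fK.
by exists (g y); [split=> //; exact: gA|exact: gK].
Qed.

Lemma connected_locally_constant (T : topologicalType) (A : set T) (P : T -> Prop) :
  connected A ->
  (forall a, A a -> \forall b \near a, A b -> (P a <-> P b)) ->
  forall a b, A a -> A b -> P a -> P b.
Proof.
move=> cA locP a b Aa Ab Pa.
(* Local persistence gives relative openness; applied to [P] and to its negation, it makes [P]
   clopen in [A]. *)
have opn (Q : T -> Prop) : (forall a, A a -> \forall b \near a, A b -> (Q a -> Q b)) ->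
    exists2 C, open C & A `&` Q = A `&` C.
  move=> locQ; exists ([set c | A c -> Q c]°); first exact: open_interior.
  apply/seteqP; split=> c [Ac Qc]; split=> //; last exact: (interior_subset Qc).
  by apply: filterS (locQ c Ac) => d cd Ad; exact: cd.
have [|C oC PC] := opn P.
  by move=> c Ac; apply: filterS (locP c Ac) => d cd Ad; case: (cd Ad).
have [|D oD PD] := opn (~` P).
  move=> c Ac; apply: filterS (locP c Ac) => d cd Ad nPc Pd; apply: nPc.
  by case: (cd Ad) => _; apply.
suff : (A `&` P) b by case.
rewrite (cA (A `&` P)) //; first by exists a.
  by exists C.
exists (~` D); first exact: open_closedC.
apply/seteqP; split=> c [Ac Pc]; split=> //.
  by move=> Dc; have : (A `&` D) c by []; rewrite -PD => -[_]; apply.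
by apply: contrapT => nPc; apply: Pc; have : (A `&` ~` P) c by []; rewrite PD => -[].
Qed.

(** * Recognising arcs, and chains along an arc *)

Section Arcs.
Context {R : realType} {X : metricType R}.
Implicit Types (K L A B H : set X) (x y z p q : X) (e : R).
Local Notation I01 := (`[0%R, 1%R]%classic : set R).

(** After rescaling, [h] sends [x] to 0 and [y] to 1; connectedness makes it onto the unit interval
    and compactness makes its inverse continuous. *)
Lemma continuum_inj_arc H (h : X -> R) x y : continuum H -> H x -> H y -> x <> y ->
  {within H, continuous h} ->
  (forall p q, H p -> H q -> h p = h q -> p = q) ->
  (forall p, H p -> h x <= h p <= h y) -> is_arc H.
Proof.
move=> [_ cH conH] Hx Hy xy ch hI hb.
have hxy : h x < h y.
  rewrite lt_neqAle; have /andP[-> _] := hb y Hy; rewrite andbT.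
  by apply/eqP => /(hI _ _ Hx Hy).
have d0 : h y - h x != 0 by rewrite subr_eq0 gt_eqF.
pose f p := (h p - h x) / (h y - h x).
have cf : {within H, continuous f}.
  move=> p; apply: cvgMl; apply: cvgB; last exact: cvg_cst.
  exact: ch.
have fb p : H p -> I01 (f p).
  move=> /hb /andP[xp py]; rewrite /= in_itv/=; apply/andP; split.
    by rewrite divr_ge0// subr_ge0// ltW.
  by rewrite ler_pdivrMr ?subr_gt0// mul1r lerD2r.
have fsurj t : I01 t -> exists2 p, H p & f p = t.
  rewrite /= in_itv/= => t01.
  have /connected_intervalP fHi : connected (f @` H).
    exact: connected_continuous_connected.
  have [] := fHi 0 1 _ _ t t01.
  - by exists x => //; rewrite /f subrr mul0r.
  - by exists y => //; rewrite /f divff.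
  - by move=> p Hp <-; exists p.
(* A chosen preimage in [H]; [x] is a default value off the image. *)
pose g t := if pselect (exists2 p, H p & f p = t) is left e then projT1 (cid2 e) else x.
have gP t : I01 t -> H (g t) /\ f (g t) = t.
  by move=> /fsurj ex; rewrite /g; case: pselect => // e; case: cid2.
have fI p q : H p -> H q -> f p = f q -> p = q.
  move=> Hp Hq fpq; apply: hI => //.
  by apply: (addIr (- h x)); apply: (mulIf (invr_neq0 d0)).
apply: (compact_bij_homeomorphic (f := f) (g := g)) => //.
- exact: metric_hausdorff.
- by move=> t /gP[].
- by move=> p Hp; have [] := gP (f p) (fb p Hp) => Hg /fI; apply.
- by move=> t /gP[].
Qed.

Lemma EA_ECC x y : EA x y -> ECC x y.
Proof.
move=> [->|[A [[f [g [[fA gA] [fK gK] cf cg]]] Ax Ay]]] e e0; first exact: linked_refl.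
rewrite -(gK _ Ay).
have := @connected_locally_constant _ I01 (fun t => linked e x (f t)).
apply; last 3 first.
- exact: gA Ax.
- exact: gA Ay.
- by rewrite gK//; exact: linked_refl.
- exact: segment_connected.
(* Points within [e / 4] of [f a] are within [e / 2] of each other; the slack absorbs the non-strict
   bound on the diameter. *)
move=> a a01; have e4 : 0 < e / 4 by rewrite divr_gt0.
have near_fa : \forall b \near a, I01 b -> ball (f a) (e / 4) (f b).
  have /subspace_continuousP/(_ a a01) cfa := cf.
  by have := cfa _ (nbhsx_ballx (f a) _ e4); rewrite /= nbhs_simpl.
move: near_fa => /nbhs_ballP[r /= r0 ra].
near=> b; move=> b01.
have br : ball a r b by near: b; exact: nbhsx_ballx.
(* The segment between [a] and [b] in either order; its image is the small link joining [f a] to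
   [f b]. *)
pose J := [set` `[Num.min a b, Num.max a b]].
have J01 : J `<=` I01.
  move=> t; move: a01 b01; rewrite /J /= !in_itv/= ge_min le_max.
  move=> /andP[a0 a1] /andP[b0 b1] /andP[/orP[] ? /orP[] ?]; lra.
have Ja : J a by rewrite /J /= in_itv/= ge_min le_max lexx.
have Jb : J b by rewrite /J /= in_itv/= ge_min le_max lexx !orbT.
have Jr t : J t -> ball a r t.
  move: br; rewrite /J /ball/= in_itv/= ge_min le_max !ltr_norml.
  by move=> /andP[? ?] /andP[/orP[] ? /orP[] ?]; apply/andP; lra.
have cfJ : {within J, continuous f} by exact: continuous_subspaceW cf.
have cL : continuum (f @` J).
  split; first by exists (f a), a.
    by apply: continuous_compact => //; exact: segment_compact.
  by apply: connected_continuous_connected => //; exact: segment_connected.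
have dL : (diameter (f @` J) < e%:E)%E.
  apply: (@le_lt_trans _ _ (e / 2)%:E); last by rewrite lte_fin; lra.
  apply: diameter_le => _ _ [s Js <-] [t Jt <-].
  have := ra s (Jr s Js) (J01 s Js); have := ra t (Jr t Jt) (J01 t Jt).
  rewrite !ballEmdist/= => at_ as_.
  have := metric_triangle (f s) (f a) (f t); rewrite (metric_sym (f s) (f a)); lra.
have La : (f @` J) (f a) by exists a.
have Lb : (f @` J) (f b) by exists b.
split; [exact: (linked_extend cL dL La Lb)|exact: (linked_extend cL dL Lb La)].
Unshelve. all: by end_near. Qed.

End Arcs.

(** The point [x] rules out an empty [D], which no sequence enumerates. *)
Lemma dense_sequence (T : topologicalType) (D : set T) (x : T) :
  countable D -> dense D -> exists u : nat -> T, dense (range u).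
Proof.
move=> /pfcard_geP[D0|[u]] dD.
  have [|p []] := dD setT _ openT; first by exists x.
  by rewrite D0.
exists u => O O0 oO; have [p [Op Dp]] := dD O O0 oO.
have [n _ unp] := 'surj_u Dp.
by exists p; split=> //; exists n.
Qed.

(** * The hull of two distinct points is an arc *)

Section HullArc.
Context {R : realType} {X : metricType R}.
Implicit Types (x y p q : X).
Hypothesis connI : forall C1 C2 : set X,
  continuum C1 -> continuum C2 -> connected (C1 `&` C2).
Variable u : nat -> X.
Hypothesis denseu : dense (range u).

(** The sign makes it increase with the hull, since [remoteness] reverses inclusion. *)
Let height x p : R := - remoteness u (hull x p).

Lemma hull_height_lt x y p q : ECC x y -> hull x y p -> hull x y q ->
  hull x q p -> p <> q -> height x p < height x q.
Proof.
move=> xy xyp xyq xqp pq.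
have xp := ECC_hull xy xyp; have xq := ECC_hull xy xyq.
rewrite ltrN2; apply: (@remoteness_lt _ _ _ _ _ q) => //.
- by apply: compact_metric_closed; have [] := hull_continuum connI xp.
- by exists x; exact: hull_l.
- exact: hull_subr.
- exact: hull_r.
(* The inclusion of hulls is strict, by antisymmetry with [x] as the common endpoint. *)
- rewrite hullC => xpq; apply: pq; move: xqp; rewrite hullC => xqp.
  exact: hull_antisym (ECC_sym xp) xpq xqp.
Qed.

Lemma hull_height_inj x y p q : ECC x y -> hull x y p -> hull x y q ->
  height x p = height x q -> p = q.
Proof.
move=> xy xyp xyq hpq; apply: contrapT => npq.
have [xqp|xpq] := hull_total connI xy xyp xyq.
  by have := hull_height_lt xy xyp xyq xqp npq; rewrite hpq ltxx.
have := hull_height_lt xy xyq xyp xpq (fun qp => npq (esym qp)).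
by rewrite hpq ltxx.
Qed.

(** Adding [L] to [hull x p] gives a continuum through [x] and [q], so [hull x q] stays within [e]
    of [hull x p]. Exchanging [p] and [q] bounds the other side. *)
Lemma hull_height_near x p q (L : set X) e : 0 < e -> ECC x p -> ECC x q ->
  continuum L -> (diameter L < e%:E)%E -> L p -> L q ->
  height x q <= height x p + e.
Proof.
move=> e0 xp xq cL dL Lp Lq; rewrite lerNl opprD opprK lerBlDr.
apply: remoteness_le; first exact: ltW.
- by exists x; exact: hull_l.
- by exists x; exact: hull_l.
have qL : hull x q `<=` hull x p `|` L.
  apply: hull_min.
  - apply: continuumU cL; last exact: hull_continuum.
    by exists p; split=> //; exact: hull_r.
  - by left; exact: hull_l.
  - by right.
move=> w /qL[xpw|Lw]; first by exists w; rewrite ?mdistxx ?ltW.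
by exists p; [exact: hull_r|rewrite ltW// (mdist_diameter dL)].
Qed.

Lemma hull_arc x y : ECC x y -> x <> y -> is_arc (hull x y).
Proof.
move=> xy nxy; have cH := hull_continuum connI xy.
have Hx := @hull_l _ _ x y; have Hy := @hull_r _ _ x y.
apply: (continuum_inj_arc (h := height x) cH Hx Hy nxy).
- apply/subspace_continuousP => p xyp; apply/cvgrPdist_le => e e0.
  rewrite near_withinE; apply: filterS (ECC_hull_near p xy e0) => q near_q xyq.
  have [L [cL dL Lp Lq]] := near_q xyq.
  have xp := ECC_hull xy xyp; have xq := ECC_hull xy xyq.
  rewrite ler_distl; apply/andP; split.
    by rewrite lerBlDr (hull_height_near _ _ _ cL dL).
  by rewrite (hull_height_near _ _ _ cL dL).
- by move=> p q; exact: hull_height_inj.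
(* The inclusions of [hull x x] in [hull x p] and of [hull x p] in [hull x y] put the extreme
   heights at [x] and [y]. *)
- move=> p xyp; have xp := ECC_hull xy xyp; rewrite !lerN2; apply/andP; split.
    apply: remoteness_anti; first by exists x; exact: hull_l.
    by apply: hull_subr => //; exact: hull_l.
  apply: remoteness_anti; first by exists x; exact: hull_l.
  exact: hull_subr.
Qed.

End HullArc.

Theorem lemma46 (R : realType) (X : metricType R)
  (polishX : polish_space R X)
  (connI : forall C1 C2 : set X,
     continuum C1 -> continuum C2 -> connected (C1 `&` C2)) :
  @ECC R X = @EA R X.
Proof.
apply/funext => x; apply/funext => y; apply/propext; split; last exact: EA_ECC.
have [[D cD dD] _] := polishX; have [u du] := dense_sequence x cD dD.
(* Equal points are set aside, as their hull is a single point and not an arc. *)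
move=> xy; have [|nxy] := pselect (x = y); first by left.
right; exists (hull x y); split; [exact: (hull_arc connI du)|exact: hull_l|exact: hull_r].
Qed.
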